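(* Let $p$ be an odd prime, $n\ge 1$ and $i\ge 1$. On the localization $D_n[Q_{n,0}^{-1}]$ the operator $$\delta_i:=(-1)^n Q_{n,0}^{-1}\,\mathrm{St}^{\Delta_i}\colon D_n[Q_{n,0}^{-1}]\longrightarrow D_n[Q_{n,0}^{-1}]$$ is a well-defined $\mathbb{F}_p$-linear derivation. Its values on the Dickson generators are $$\delta_i(Q_{n,s})=P_{n,i,s}^{\,p}+R_{n,i}^{\,p}\,Q_{n,s}\qquad(0\le s<n).$$ In particular, for every $F\in D_n[Q_{n,0}^{-1}]$ one has $\delta_i(F^p)=0$ and $\mathrm{St}^{\Delta_i}(F^p)=0$.
   Context: Let $p$ be an odd prime, $n\ge 1$, $i\ge 1$, and $P_n=\mathbb{F}_p[x_1,\dots,x_n]$. For integers $e_1,\dots,e_n\ge 0$ put $[e_1,\dots,e_n]:=\det\big(x_r^{p^{e_s}}\big)_{1\le r,s\le n}\in P_n$. Let $L_n=[0,1,\dots,n-1]$ and $L_{n,s}=[0,1,\dots,\widehat{s},\dots,n]$ for $0\le s<n$ (a hat means omission). The Dickson invariants are $Q_{n,s}=L_{n,s}/L_n$ $(0\le s<n)$; in particular $Q_{n,0}=L_n^{p-1}$. The Dickson algebra is $D_n=P_n^{\mathrm{GL}_n(\mathbb{F}_p)}=\mathbb{F}_p[Q_{n,0},\dots,Q_{n,n-1}]$, a polynomial algebra on these generators. $\mathrm{St}^{\Delta_i}$ denotes the Steenrod--Milnor operation dual to the monomial $\xi_i$ in Milnor's dual mod-$p$ Steenrod algebra. It acts on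 $P_n$ as the unique $\mathbb{F}_p$-linear derivation with $\mathrm{St}^{\Delta_i}(x_r)=x_r^{p^i}$ $(1\le r\le n)$, and it maps $D_n$ into $D_n$. On a localization of $D_n$, $\mathrm{St}^{\Delta_i}$ means the unique derivation extending $\mathrm{St}^{\Delta_i}|_{D_n}$ (quotient rule). Set $P_{n,i,0}:=0$, $P_{n,i,s}:=-\dfrac{[0,1,\dots,\widehat{s-1},\dots,n-1,i-1]}{L_n}$ for $0<s<n$, and $R_{n,i}:=\dfrac{[0,1,\dots,n-2,i-1]}{L_n}$ (for $n=1$, $R_{1,i}=[i-1]/L_1$). These quotients lie in $D_n$. *)

(* Defs.v *)
From HB Require Import structures.
From mathcomp Require Import all_boot all_order all_algebra perm fingroup.
From mathcomp Require Import finfield mpoly boolp.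

Set Implicit Arguments.
Unset Strict Implicit.
Unset Printing Implicit Defensive.

Import GRing.Theory.
Local Open Scope ring_scope.

Definition is_derivation (k : nzRingType) (A : algType k) (d : A -> A) : Prop :=
  linear d /\ (forall f g, d (f * g) = d f * g + f * d g).

Notation "x %:F" := (@FracField.tofrac _ x) : ring_scope.

Section Dickson.
Variables (p n : nat).
Local Notation P := {mpoly 'F_p[n]}.
Local Notation K := {fraction {mpoly 'F_p[n]}}.

(* [e_1, ..., e_n]; the list [e] is meant to have size [n]. *)
Definition bracket (e : seq nat) : P :=
  \det (\matrix_(r < n, s < n) 'X_r ^+ (p ^ nth 0%N e s)).

(* The quotient [e_1, ..., e_n] / L_n, taken in the fraction field of [P]. *)
Definition bracket_frac (e : seq nat) : K :=
  (bracket e)%:F / (bracket (iota 0 n))%:F.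

Definition omit (s : nat) (e : seq nat) : seq nat := [seq k <- e | k != s].

Definition dickson_Q (s : nat) : K := bracket_frac (omit s (iota 0 n.+1)).

(* Invariance under all of GL_n does not depend on whether one substitutes by
   [A], its transpose or its inverse. *)
Definition lin_subst (A : 'M['F_p]_n) (f : P) : P :=
  f \mPo [tuple \sum_(j < n) A r j *: 'X_j | r < n].

Definition dickson_alg : {pred P} :=
  [pred f : P | [forall A : 'M['F_p]_n,
                   (A \in unitmx) ==> (lin_subst A f == f)]].

Definition dickson_loc_pred : {pred K} :=
  fun F => `[< exists f (k : nat),
                 f \in dickson_alg /\ F = f%:F / dickson_Q 0 ^+ k >].

(* [St_derivation], [St_X] and [St_unique] below: [St i] is the unique F_p-linear
   derivation sending each variable to its [p ^ i]-th power. *)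
Definition St (i : nat) (f : P) : P :=
  \sum_(r < n) f^`M(r) * 'X_r ^+ (p ^ i).

Lemma St_derivation i : is_derivation (St i).
Proof.
split=> [c f g|f g].
  rewrite /St scaler_sumr -big_split; apply: eq_bigr => r _ /=.
  by rewrite mderivD mderivZ mulrDl scalerAl.
rewrite /St mulr_suml mulr_sumr -big_split; apply: eq_bigr => r _ /=.
by rewrite mderivM mulrDl mulrAC mulrA.
Qed.

Lemma St_X i r : St i 'X_r = 'X_r ^+ (p ^ i).
Proof.
rewrite /St (bigD1 r) //= big1 => [|s sr].
  rewrite mderivX mnm1E eqxx scale1r (_ : (U_(r) - U_(r))%MM = 0%MM).
    by rewrite mpolyX0 mul1r addr0.
  by apply/mnmP => j; rewrite mnmBE mnm0E subnn.
by rewrite mderivX mnm1E eq_sym (negPf sr) scale0r mul0r.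
Qed.

Lemma St_unique i (d : P -> P) :
  is_derivation d -> (forall r, d 'X_r = 'X_r ^+ (p ^ i)) -> d =1 St i.
Proof.
move=> [dl dM] dX; have [sl sM] := St_derivation i.
have d1 (e : P -> P) : (forall f g, e (f * g) = e f * g + f * e g) -> e 1 = 0.
  move=> eM; apply: (addrI (e 1)); rewrite addr0.
  by have := eM 1 1; rewrite !mulr1 mul1r.
have z (e : P -> P) : linear e -> e 0 = 0.
  move=> el; have := el 1 0 0; rewrite !scale1r addr0 => h.
  by apply: (addrI (e 0)); rewrite addr0 -h.
have prd (u v : P) : d u = St i u -> d v = St i v -> d (u * v) = St i (u * v).
  by move=> du dv; rewrite dM sM du dv.
have dm m : d 'X_[m] = St i 'X_[m].
  rewrite mpolyXE_id; apply: (big_ind (fun u => d u = St i u)) => //.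
    by rewrite !d1.
  move=> r _; elim: (m r) => [|k IH]; first by rewrite expr0 !d1.
  by rewrite exprS; apply: prd; rewrite ?dX ?St_X.
move=> f; elim/mpolyind: f => [|c m f _ _ IH]; first by rewrite !z.
by rewrite dl sl dm IH.
Qed.

Lemma lin_subst1 A : lin_subst A 1 = 1.
Proof. exact: rmorph1. Qed.

Lemma lin_substB A : {morph lin_subst A : f g / f - g}.
Proof. exact: rmorphB. Qed.

Lemma lin_substM A : {morph lin_subst A : f g / f * g}.
Proof. exact: rmorphM. Qed.

Lemma lin_substX A k : {morph lin_subst A : f / f ^+ k}.
Proof. exact: rmorphXn. Qed.

Lemma dickson_algP f :
  reflect (forall A, A \in unitmx -> lin_subst A f = f) (f \in dickson_alg).
Proof.
apply: (iffP forallP) => h A; first by move=> uA; apply/eqP/(implyP (h A)).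
by apply/implyP => uA; apply/eqP/h.
Qed.

Lemma dickson_alg_subring : subring_closed dickson_alg.
Proof.
split=> [|f g /dickson_algP hf /dickson_algP hg
         |f g /dickson_algP hf /dickson_algP hg];
  apply/dickson_algP => A uA.
- exact: lin_subst1.
- by rewrite lin_substB hf // hg.
- by rewrite lin_substM hf // hg.
Qed.
HB.instance Definition _ :=
  GRing.isSubringClosed.Build P dickson_alg dickson_alg_subring.

Lemma dickson_locP F :
  reflect (exists f (k : nat), f \in dickson_alg /\ F = f%:F / dickson_Q 0 ^+ k)
          (F \in dickson_loc_pred).
Proof. exact: asboolP. Qed.

Hypothesis p_pr : prime p.

Let pcharP : p \in [pchar P].
Proof. by rewrite (rmorph_pchar (@mpolyC n 'F_p)) // pchar_Fp. Qed.

Let pchar_exp e : [pchar P].-nat (p ^ e)%N.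
Proof. by rewrite pnatX (pnatE _ p_pr) pcharP. Qed.

Let Fp_exp e (c : 'F_p) : c ^+ (p ^ e) = c.
Proof.
elim: e => [|e IH]; first by rewrite expr1.
by rewrite expnSr exprM IH -[in X in _ ^+ X](card_Fp p_pr) expf_card.
Qed.

Let p1E : p.-1.+1 = p.
Proof. by rewrite prednK // prime_gt0. Qed.

Let p2E : p.-2.+1 = p.-1.
Proof. by rewrite prednK // -ltnS p1E prime_gt1. Qed.

Let exprp (R : pzSemiRingType) (x : R) : x ^+ p = x ^+ p.-1 * x.
Proof. by rewrite -exprSr; congr (_ ^+ _); rewrite p1E. Qed.

Let mpolyCX (c : 'F_p) k : (c ^+ k)%:MP = c%:MP ^+ k :> P.
Proof. exact: rmorphXn. Qed.

Lemma lin_subst_bracket A e :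
  lin_subst A (bracket e) = (\det A)%:MP * bracket e.
Proof.
rewrite /lin_subst /bracket -det_map_mx.
rewrite -(det_map_mx (@mpolyC n 'F_p)) -det_mulmx; congr (\det _).
apply/matrixP => r s; rewrite !mxE rmorphXn /= comp_mpolyXU -tnth_nth tnth_mktuple.
rewrite (@big_morph _ _ (fun f : P => f ^+ (p ^ nth 0%N e s)) 0 +%R) //=.
- apply: eq_bigr => j _.
  by rewrite !mxE exprZn Fp_exp mul_mpolyC.
- by move=> f g; apply: exprDn_pchar.
- by rewrite expr0n expn_eq0 -leqn0 leqNgt prime_gt0.
Qed.

Lemma bracket_iota_neq0 : bracket (iota 0 n) != 0.
Proof.
pose m (s : {perm 'I_n}) := [multinom (p ^ s r)%N | r < n].
have prodE (s : {perm 'I_n}) : \prod_i (\matrix_(r < n, k < n)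
    ('X_r ^+ (p ^ nth 0%N (iota 0 n) k) : P)) i (s i) = 'X_[m s].
  rewrite mpolyXE_id; apply: eq_bigr => r _.
  by rewrite !mxE mnmE nth_iota ?add0n.
have nz : (bracket (iota 0 n))@_(m 1%g) = 1.
  rewrite /bracket /determinant raddf_sum (bigD1 1%g) //=.
  rewrite [X in _ + X]big1 ?addr0 => [|s ns].
    by rewrite odd_perm1 expr0 mul1r prodE mcoeffX eqxx.
  rewrite prodE -[X in X * _](rmorph_sign (@mpolyC n 'F_p)) mcoeffCM mcoeffX.
  case: eqP => [|_]; last by rewrite mulr0.
  move=> /mnmP eq_m; case/eqP: ns; apply/permP => r; apply: val_inj.
  by have /eqP := eq_m r; rewrite !mnmE eqn_exp2l ?prime_gt1 // => /eqP.
by apply: contraTneq isT => z; move: nz;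
  rewrite z mcoeff0 => /esym/eqP; rewrite oner_eq0.
Qed.

Lemma dickson_Q0E : dickson_Q 0 = (bracket (iota 0 n) ^+ p.-1)%:F.
Proof.
rewrite /dickson_Q /bracket_frac.
have -> : bracket (omit 0 (iota 0 n.+1)) = bracket (iota 0 n) ^+ p.
  have -> : omit 0 (iota 0 n.+1) = iota 1 n.
    by rewrite /omit /=; apply/all_filterP/allP => k; rewrite mem_iota; case: k.
  rewrite -(pFrobenius_autE pcharP) /bracket -det_map_mx; congr (\det _).
  apply/matrixP => r s; rewrite !mxE !nth_iota //= pFrobenius_autE -exprM.
  by rewrite add0n add1n expnSr.
by rewrite exprp tofracM mulfK // tofrac_eq0 bracket_iota_neq0.
Qed.

Lemma dickson_Q0_neq0 : dickson_Q 0 != 0.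
Proof. by rewrite dickson_Q0E tofrac_eq0 expf_neq0 // bracket_iota_neq0. Qed.

Let bracketM_dickson e : bracket e * bracket (iota 0 n) ^+ p.-2 \in dickson_alg.
Proof.
apply/dickson_algP => A uA.
have uA0 : \det A != 0 by rewrite -unitfE -unitmxE.
rewrite lin_substM lin_substX.
apply: (etrans (congr2 *%R (lin_subst_bracket A e)
  (congr1 (fun f => f ^+ p.-2) (lin_subst_bracket A (iota 0 n))))).
rewrite exprMn mulrACA -exprS -mpolyCX.
suff -> : \det A ^+ p.-2.+1 = 1 by rewrite mpolyC1 mul1r.
rewrite p2E; apply: (mulIf uA0); rewrite mul1r -exprp.
exact: (Fp_exp 1).
Qed.

Lemma dickson_algX_Q0 k :
  exists2 q, q \in dickson_alg & q%:F = dickson_Q 0 ^+ k.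
Proof.
exists ((bracket (iota 0 n) ^+ p.-1) ^+ k); last by rewrite dickson_Q0E tofracXn.
apply: rpredX; have := bracketM_dickson (iota 0 n); rewrite -exprS.
by rewrite p2E.
Qed.

Lemma bracket_frac_loc e : bracket_frac e \in dickson_loc_pred.
Proof.
apply/dickson_locP; exists (bracket e * bracket (iota 0 n) ^+ p.-2), 1%N.
split; first exact: bracketM_dickson.
rewrite expr1 dickson_Q0E /bracket_frac -p2E.
move: (bracket (iota 0 n)) bracket_iota_neq0 (bracket e) => L L0 b.
rewrite exprSr; move: (L ^+ p.-2) (expf_neq0 p.-2 L0) => m.
rewrite -tofrac_eq0 !tofracM => m0.
by rewrite invfM mulrA mulfK.
Qed.

Lemma dickson_loc_subring : subring_closed dickson_loc_pred.
Proof.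
have nz k := expf_neq0 k dickson_Q0_neq0.
split=> [|F G /dickson_locP[f [k [Df ->]]] /dickson_locP[g [l [Dg ->]]]
         |F G /dickson_locP[f [k [Df ->]]] /dickson_locP[g [l [Dg ->]]]].
- apply/dickson_locP; exists 1, 0%N; split; first exact: rpred1.
  by rewrite expr0 tofrac1 invr1 mulr1.
- have [u Du uE] := dickson_algX_Q0 k; have [v Dv vE] := dickson_algX_Q0 l.
  apply/dickson_locP; exists (f * v - g * u), (k + l)%N; split.
    by rewrite rpredB // rpredM.
  rewrite exprD tofracB !tofracM uE vE -mulNr.
  by rewrite (addf_div _ _ (nz k) (nz l)) mulNr.
- apply/dickson_locP; exists (f * g), (k + l)%N; split; first exact: rpredM.
  by rewrite exprD tofracM invfM mulrACA.
Qed.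

(* [dickson_loc_pred] is a subring only for [p] prime: the proof of primality
   is carried along so that the ring structure can be inferred. *)
Definition dickson_loc_mem (_ : prime p) : {pred K} := dickson_loc_pred.

End Dickson.

Arguments dickson_alg : clear implicits.

HB.instance Definition _ (p n : nat) (p_pr : prime p) :=
  GRing.isSubringClosed.Build _ (@dickson_loc_mem p n p_pr)
    (dickson_loc_subring n p_pr).

Record dickson_loc (p n : nat) (p_pr : prime p) := DicksonLoc {
  dickson_loc_val :> {fraction {mpoly 'F_p[n]}};
  _ : dickson_loc_val \in dickson_loc_mem p_pr }.

Section DicksonLoc.
Variables (p n : nat) (p_pr : prime p).
Local Notation D := (dickson_loc n p_pr).

HB.instance Definition _ := [isSub for @dickson_loc_val p n p_pr].
HB.instance Definition _ := [Choice of D by <:].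
HB.instance Definition _ := [SubChoice_isSubComNzRing of D by <:].

Definition loc_bracket_frac (e : seq nat) : D :=
  DicksonLoc (bracket_frac_loc n p_pr e : _ \in dickson_loc_mem p_pr).

Lemma loc_const_subproof (c : 'F_p) :
  (c%:MP : {mpoly 'F_p[n]})%:F \in dickson_loc_mem p_pr.
Proof.
apply/dickson_locP; exists c%:MP, 0%N; split; last by rewrite expr0 invr1 mulr1.
by apply/dickson_algP => A _; rewrite /lin_subst comp_mpolyC.
Qed.
Definition loc_const (c : 'F_p) : D := DicksonLoc (loc_const_subproof c).

Definition loc_scale (c : 'F_p) (F : D) : D := loc_const c * F.

Fact loc_scaleA a b F : loc_scale a (loc_scale b F) = loc_scale (a * b) F.
Proof. by apply: val_inj; rewrite /= mulrA rmorphM tofracM. Qed.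

Fact loc_scale1 : left_id 1 loc_scale.
Proof. by move=> F; apply: val_inj; rewrite /= mpolyC1 tofrac1 mul1r. Qed.

Fact loc_scaleDr : right_distributive loc_scale +%R.
Proof. by move=> a F G; apply: val_inj; rewrite /= mulrDr. Qed.

Fact loc_scaleDl F : {morph loc_scale^~ F : a b / a + b}.
Proof. by move=> a b; apply: val_inj; rewrite /= rmorphD tofracD mulrDl. Qed.

HB.instance Definition _ := GRing.Zmodule_isLmodule.Build 'F_p D
  loc_scaleA loc_scale1 loc_scaleDr loc_scaleDl.

Fact loc_scaleAl a (F G : D) : a *: (F * G) = (a *: F) * G.
Proof. by apply: val_inj; rewrite /= mulrA. Qed.

HB.instance Definition _ := GRing.Lmodule_isLalgebra.Build 'F_p D loc_scaleAl.
HB.instance Definition _ := GRing.Lalgebra_isComAlgebra.Build 'F_p D.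

Lemma loc_Q0V_subproof : (dickson_Q p n 0)^-1 \in dickson_loc_mem p_pr.
Proof.
apply/dickson_locP; exists 1, 1%N; split; first exact: rpred1.
by rewrite expr1 tofrac1 mul1r.
Qed.

Definition loc_Q (s : nat) : D := loc_bracket_frac (omit s (iota 0 n.+1)).

Definition loc_Q0V : D := DicksonLoc loc_Q0V_subproof.

Lemma loc_Q0VK : loc_Q 0 * loc_Q0V = 1.
Proof. by apply: val_inj; rewrite /= divff // dickson_Q0_neq0. Qed.

(* Meaningful for [0 < i], like [loc_R]. *)
Definition loc_P (i s : nat) : D :=
  if s == 0%N then 0
  else - loc_bracket_frac (rcons (omit s.-1 (iota 0 n)) i.-1).

Definition loc_R (i : nat) : D :=
  loc_bracket_frac (rcons (iota 0 n.-1) i.-1).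

(* [d] is a derivation of D_n[Q_{n,0}^-1] extending the restriction of [St i] to
   D_n. *)
Definition is_St_loc (i : nat) (d : D -> D) : Prop :=
  is_derivation d /\
  (forall (f : {mpoly 'F_p[n]}) (F : D),
     f \in dickson_alg p n -> val F = f%:F -> val (d F) = (St i f)%:F).

Definition delta (StL : D -> D) (F : D) : D := (-1) ^+ n * loc_Q0V * StL F.

End DicksonLoc.

Arguments is_St_loc {p n p_pr}.
Arguments delta {p n p_pr}.

(* Main.v *)
Require Import Defs.
From HB Require Import structures.
From mathcomp Require Import all_boot all_order all_algebra.
From mathcomp Require Import finfield mpoly generic_quotient ring.

Set Implicit Arguments.
Unset Strict Implicit.
Unset Printing Implicit Defensive.

Import GRing.Theory.
Local Open Scope ring_scope.

(* Write [v_e] for the column [(x_r ^ (p ^ e))_r].  Since [L_n] is nonzero, the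
   columns [v_0, ..., v_(n-1)] form a basis over the fraction field, and by
   Cramer's rule the coordinates of [v_e] are the bracket quotients up to sign;
   those of [v_n] are the Dickson invariants.  A derivation kills [p]-th powers,
   so applying [St i] to [v_n = \sum_s c_s v_s] leaves
   [\sum_s St i c_s * v_s = - c_0 * v_i].  Raising the expansion of [v_(i-1)]
   to the [p]-th power and substituting that of [v_n] yields the coordinates
   of [v_i], and comparing coordinates gives the formula. *)

(** * Field identities behind the quotient rule, with derivatives as free variables *)

Section QuotientRule.
Variable F : fieldType.
Implicit Types a b m n : F.

(** The last hypothesis is the derivative of [n * b = a * m], so the quotient rule gives the same
    value on two fractions that represent the same element. *)
Lemma quot_rule_unique a b m n da db dm dn : b != 0 -> m != 0 ->
  n * b = a * m -> dn * b + n * db = da * m + a * dm ->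
  dn / m - n * dm / m ^+ 2 = da / b - a * db / b ^+ 2.
Proof.
move=> b0 m0 nb dnb; have nE : n = a * m / b by rewrite -nb mulfK.
have -> : dn = (da * m + a * dm - n * db) / b by rewrite -dnb; field.
by rewrite nE; field; rewrite b0.
Qed.

Lemma quot_ruleD a b a' b' da db da' db' : b != 0 -> b' != 0 ->
  (da * b' + a * db' + (da' * b + a' * db)) / (b * b') -
    (a * b' + a' * b) * (db * b' + b * db') / (b * b') ^+ 2 =
  da / b - a * db / b ^+ 2 + (da' / b' - a' * db' / b' ^+ 2).
Proof. by move=> b0 b0'; field; rewrite ?b0 ?b0'. Qed.

Lemma quot_ruleM a b a' b' da db da' db' : b != 0 -> b' != 0 ->
  (da * a' + a * da') / (b * b') -
    (a * a') * (db * b' + b * db') / (b * b') ^+ 2 =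
  (da / b - a * db / b ^+ 2) * (a' / b') +
    a / b * (da' / b' - a' * db' / b' ^+ 2).
Proof. by move=> b0 b0'; field; rewrite ?b0 ?b0'. Qed.

Lemma quot_rule_common a b da db : b != 0 ->
  da / b - a * db / b ^+ 2 = (da * b - a * db) / (b * b).
Proof. by move=> b0; field. Qed.

End QuotientRule.

(** * Extension of a derivation to the fraction field *)

Section FractionDerivation.
Variables (R : idomainType) (d : R -> R).
Hypothesis dD : {morph d : a b / a + b}.
Hypothesis dM : forall a b, d (a * b) = d a * b + a * d b.
Local Notation K := {fraction R}.

Lemma fraction_numden (x : K) :
  x = (\n_(repr x))%:F / (\d_(repr x))%:F.
Proof.
suff H : x * (\d_(repr x))%:F = (\n_(repr x))%:F.
  by rewrite -H mulfK ?tofrac_eq0 ?denom_ratioP.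
(* Replacing the class by that of its own representative makes both sides depend on one and the same
   pair, on which the product can be computed. *)
elim/quotW: x => r; rewrite -[X in X * _]reprK.
move: (repr _) => {}r; unlock FracField.tofrac; rewrite -[LHS]FracField.pi_mul.
apply/eqmodP; rewrite /= FracField.equivfE.
rewrite /FracField.mulf !numden_Ratio ?mulf_neq0 ?oner_eq0 ?denom_ratioP //.
by rewrite !mulr1 mulrC eqxx.
Qed.

Lemma fraction_div (x : K) : exists a b, b != 0 /\ x = a%:F / b%:F.
Proof.
by exists \n_(repr x), \d_(repr x); rewrite -fraction_numden denom_ratioP.
Qed.

(** The quotient rule on the chosen representative; [frac_deriv_div] removes the dependence on this
    choice. *)
Definition frac_deriv (x : K) : K :=
  let r := repr x in
  (d \n_r)%:F / (\d_r)%:F - (\n_r)%:F * (d \d_r)%:F / (\d_r)%:F ^+ 2.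

Lemma frac_deriv_div a b : b != 0 ->
  frac_deriv (a%:F / b%:F) = (d a)%:F / b%:F - a%:F * (d b)%:F / b%:F ^+ 2.
Proof.
move=> b0; rewrite /frac_deriv; set x : K := a%:F / b%:F.
have m0 : \d_(repr x) != 0 by apply: denom_ratioP.
have xE := fraction_numden x.
move: (\d_(repr x)) (\n_(repr x)) m0 xE => m n m0 xE.
have nb : n * b = a * m.
  apply/eqP; rewrite -tofrac_eq !tofracM -eqr_div ?tofrac_eq0 //.
  by rewrite -xE.
have := congr1 (fun z => (d z)%:F : K) nb.
move: nb => /(congr1 (@FracField.tofrac R)).
rewrite !dM !tofracD !tofracM => nb dnb.
by apply: quot_rule_unique; rewrite ?tofrac_eq0.
Qed.

Lemma frac_deriv_tofrac a : frac_deriv a%:F = (d a)%:F.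
Proof.
have d1 : d 1 = 0.
  by apply: (addrI (d 1)); rewrite addr0 -[in RHS](mulr1 1) dM mulr1 mul1r.
rewrite -[X in frac_deriv X]divr1 -tofrac1 frac_deriv_div ?oner_eq0 //.
by rewrite d1 tofrac0 mulr0 mul0r subr0 tofrac1 divr1.
Qed.

Lemma frac_derivD : {morph frac_deriv : x y / x + y}.
Proof.
move=> x y; have [a [b [b0 ->]]] := fraction_div x.
have [a' [b' [b0' ->]]] := fraction_div y.
have fb0 : (b%:F : K) != 0 by rewrite tofrac_eq0.
have fb0' : (b'%:F : K) != 0 by rewrite tofrac_eq0.
rewrite addf_div // -!tofracM -tofracD !frac_deriv_div ?mulf_neq0 //.
by rewrite dD !dM !tofracD !tofracM quot_ruleD.
Qed.

Lemma frac_derivM x y :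
  frac_deriv (x * y) = frac_deriv x * y + x * frac_deriv y.
Proof.
have [a [b [b0 ->]]] := fraction_div x.
have [a' [b' [b0' ->]]] := fraction_div y.
have fb0 : (b%:F : K) != 0 by rewrite tofrac_eq0.
have fb0' : (b'%:F : K) != 0 by rewrite tofrac_eq0.
rewrite mulf_div -!tofracM !frac_deriv_div ?mulf_neq0 //.
by rewrite !dM !tofracD !tofracM quot_ruleM.
Qed.

End FractionDerivation.

(** * Formal consequences of the Leibniz rule *)

Section Leibniz.
Variables (R : pzRingType) (d : R -> R).
Hypothesis dD : {morph d : a b / a + b}.
Hypothesis dM : forall a b, d (a * b) = d a * b + a * d b.

Lemma leibniz0 : d 0 = 0.
Proof. by apply: (addrI (d 0)); rewrite -dD !addr0. Qed.

Lemma leibniz1 : d 1 = 0.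
Proof.
by apply: (addrI (d 1)); rewrite addr0 -[in RHS](mulr1 1) dM mulr1 mul1r.
Qed.

Lemma leibnizN a : d (- a) = - d a.
Proof. by apply: (addrI (d a)); rewrite -dD !subrr leibniz0. Qed.

Lemma leibniz_sign k a : d ((-1) ^+ k * a) = (-1) ^+ k * d a.
Proof.
elim: k => [|k IH]; first by rewrite expr0 !mul1r.
by rewrite exprS !mulN1r !mulNr leibnizN IH.
Qed.

Lemma leibniz_sum I (r : seq I) (F : I -> R) :
  d (\sum_(j <- r) F j) = \sum_(j <- r) d (F j).
Proof. exact: (big_morph d dD leibniz0). Qed.

End Leibniz.

Lemma leibniz_pchar (R : comPzRingType) (p : nat) (d : R -> R) :
  (forall a b, d (a * b) = d a * b + a * d b) -> (p%:R = 0 :> R) ->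
  forall a, d (a ^+ p) = 0.
Proof.
move=> dM pR a.
(* The truncated exponent at [k = 0] is harmless, since its coefficient is zero. *)
suff dX k : d (a ^+ k) = k%:R * (a ^+ k.-1 * d a) by rewrite dX pR mul0r.
elim: k => [|k IH]; first by rewrite expr0 mul0r (leibniz1 dM).
rewrite exprS dM {}IH /=; case: k => [|k] /=.
  by rewrite expr0 mul0r mulr0 addr0 mulr1 !mul1r.
rewrite exprS -[k.+2]addn1 natrD; ring.
Qed.

(** * The Steenrod derivation on invariants and on the fraction field *)

Section SteenrodFraction.
Variables (p n i : nat).
Hypothesis p_pr : prime p.
Local Notation P := {mpoly 'F_p[n]}.
Local Notation K := {fraction {mpoly 'F_p[n]}}.

Lemma StD : {morph @St p n i : f g / f + g}.
Proof.
move=> f g; have [dl _] := St_derivation p n i.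
by have := dl 1 f g; rewrite !scale1r.
Qed.

Lemma StM f g : St i (f * g) = St i f * g + f * St i g :> P.
Proof. by have [_ ->] := St_derivation p n i. Qed.

Lemma StZ c f : St i (c *: f) = c *: St i f :> P.
Proof.
have [dl _] := St_derivation p n i.
by rewrite -[c *: f]addr0 dl (leibniz0 StD) addr0.
Qed.

Lemma St_const c : St i c%:MP = 0 :> P.
Proof. by rewrite -[c%:MP]mulr1 mul_mpolyC StZ (leibniz1 StM) scaler0. Qed.

Lemma mpoly_pchar : p \in [pchar P].
Proof. by rewrite (rmorph_pchar (@mpolyC n 'F_p)) // pchar_Fp. Qed.

Lemma fraction_pchar : p \in [pchar K].
Proof. exact: (rmorph_pchar (@FracField.tofrac P)) mpoly_pchar. Qed.

Lemma pnat_exp (R : nzSemiRingType) e :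
  p \in [pchar R] -> [pchar R].-nat (p ^ e)%N.
Proof. by move=> pR; rewrite pnatX (pnatE _ p_pr) pR. Qed.

Lemma Fp_expX e (c : 'F_p) : c ^+ (p ^ e) = c.
Proof.
elim: e => [|e IH]; first by rewrite expr1.
by rewrite expnSr exprM IH -[in X in _ ^+ X](card_Fp p_pr) expf_card.
Qed.

Lemma sum_expX (R : comNzRingType) e I (r : seq I) (F : I -> R) :
  p \in [pchar R] ->
  (\sum_(j <- r) F j) ^+ (p ^ e) = \sum_(j <- r) F j ^+ (p ^ e).
Proof.
move=> pR; apply: (big_morph (fun f : R => f ^+ (p ^ e))) => [f g|].
  by rewrite exprDn_pchar ?pnat_exp.
by rewrite expr0n expn_eq0 -leqn0 leqNgt prime_gt0.
Qed.

Lemma lin_subst_X (A : 'M['F_p]_n) r :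
  lin_subst A 'X_r = \sum_(j < n) A r j *: 'X_j.
Proof. by rewrite /lin_subst comp_mpolyXU -tnth_nth tnth_mktuple. Qed.

(** On a variable both sides agree because Frobenius is additive and fixes the coefficients in
    ['F_p]. The Leibniz rule carries this to monomials, linearity to all polynomials. Hence [St i]
    preserves invariance. *)
Lemma lin_subst_St (A : 'M['F_p]_n) (f : P) :
  lin_subst A (St i f) = St i (lin_subst A f).
Proof.
have sD : {morph lin_subst A : g h / g + h} by apply: rmorphD.
have s0 : lin_subst A 0 = 0 by apply: rmorph0.
have sZ c g : lin_subst A (c *: g) = c *: lin_subst A g by apply: linearZ.
have prd (u v : P) : lin_subst A (St i u) = St i (lin_subst A u) ->
    lin_subst A (St i v) = St i (lin_subst A v) ->
    lin_subst A (St i (u * v)) = St i (lin_subst A (u * v)).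
  by move=> hu hv; rewrite StM sD !lin_substM StM hu hv.
have one : lin_subst A (St i 1) = St i (lin_subst A 1).
  by rewrite lin_subst1 (leibniz1 StM) s0.
have dX r : lin_subst A (St i 'X_r) = St i (lin_subst A 'X_r).
  rewrite St_X lin_substX lin_subst_X (leibniz_sum StD).
  rewrite sum_expX ?mpoly_pchar //.
  by apply: eq_bigr => j _; rewrite StZ St_X exprZn Fp_expX.
elim/mpolyind: f => [|c m f _ _ IH].
  by rewrite (leibniz0 StD) s0 (leibniz0 StD).
rewrite StD !sD StD IH; congr (_ + _); rewrite StZ !sZ StZ; congr (_ *: _).
rewrite mpolyXE_id.
apply: (big_ind (fun u => lin_subst A (St i u) = St i (lin_subst A u))).
- exact: one.
- exact: prd.
- move=> r _; elim: (m r) => [|k IHk]; first by rewrite expr0; apply: one.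
  by rewrite exprS; apply: prd; [exact: dX|exact: IHk].
Qed.

Lemma St_dickson (f : P) : f \in dickson_alg p n -> St i f \in dickson_alg p n.
Proof.
by move=> /dickson_algP hf; apply/dickson_algP => A uA; rewrite lin_subst_St hf.
Qed.

Definition frac_St : K -> K := frac_deriv (@St p n i).

Lemma frac_StD : {morph frac_St : F G / F + G}.
Proof. exact: frac_derivD StD StM. Qed.

Lemma frac_StM F G : frac_St (F * G) = frac_St F * G + F * frac_St G.
Proof. exact: frac_derivM StM F G. Qed.

Lemma frac_St_tofrac f : frac_St f%:F = (St i f)%:F.
Proof. exact: frac_deriv_tofrac StM f. Qed.

Lemma frac_St_loc F :
  F \in dickson_loc_mem p_pr -> frac_St F \in dickson_loc_mem p_pr.
Proof.
move=> /dickson_locP[f [k [Df ->]]]; apply/dickson_locP.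
have Q0 := expf_neq0 k (dickson_Q0_neq0 n p_pr).
have [q Dq qE] := dickson_algX_Q0 n p_pr k.
have q0 : q != 0 by rewrite -tofrac_eq0 qE.
(* This is the quotient rule for [f / q], where [q] is the invariant polynomial equal to the [k]-th
   power of [dickson_Q 0]; its denominator is [q * q]. *)
exists (St i f * q - f * St i q), (k + k)%N; split.
  by rewrite rpredB // rpredM // St_dickson.
rewrite exprD -qE /frac_St (frac_deriv_div StM) // tofracB !tofracM.
by apply: quot_rule_common; rewrite tofrac_eq0.
Qed.

Lemma frac_St_exp F : frac_St (F ^+ p) = 0.
Proof.
apply: (leibniz_pchar frac_StM); have := fraction_pchar; rewrite inE.
by case/andP => _ /eqP.
Qed.

End SteenrodFraction.

(** * Exponent lists with one entry omitted *)

Lemma omit_iota t m : (t <= m)%N ->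
  omit t (iota 0 m.+1) = iota 0 t ++ iota t.+1 (m - t).
Proof.
move=> tm; rewrite -(subnKC tm) -addnS iotaD /omit filter_cat /= eqxx add0n.
rewrite addKn; congr (_ ++ _); apply/all_filterP/allP => k; rewrite mem_iota.
  by case/andP => _ kt; rewrite neq_ltn kt.
by case/andP => kt _; rewrite neq_ltn kt orbT.
Qed.

Lemma size_omit_iota t m : (t <= m)%N -> size (omit t (iota 0 m.+1)) = m.
Proof. by move=> tm; rewrite omit_iota // size_cat !size_iota subnKC. Qed.

(** The index map [bump t] underlies [lift t], so omitting an exponent matches deleting a column in
    a minor. *)
Lemma nth_omit_iota t m b : (t <= m)%N -> (b < m)%N ->
  nth 0%N (omit t (iota 0 m.+1)) b = bump t b.
Proof.
move=> tm bm; rewrite omit_iota // nth_cat size_iota /bump.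
have [bt|tb] := ltnP b t; first by rewrite nth_iota.
by rewrite nth_iota ?ltn_sub2r ?(leq_ltn_trans tb) // addSn subnKC.
Qed.

Lemma omit_iota_rcons t m : (t < m)%N ->
  omit t (iota 0 m.+1) = rcons (omit t (iota 0 m)) m.
Proof.
move=> tm; rewrite /omit -addn1 iotaD cats1 filter_rcons add0n.
by rewrite neq_ltn tm orbT.
Qed.

Lemma omit_iota_last m : omit m (iota 0 m.+1) = iota 0 m.
Proof. by rewrite omit_iota // subnn cats0. Qed.

(** * Coordinates with respect to the columns of p-power exponents *)

Section Coordinates.
Variables (p m : nat).
Hypothesis p_pr : prime p.
Local Notation n := m.+1.
Local Notation P := {mpoly 'F_p[n]}.
Local Notation K := {fraction {mpoly 'F_p[n]}}.

Definition power_vec e : 'cV[K]_n := \col_r ('X_r : P)%:F ^+ (p ^ e).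

Definition power_mx : 'M[K]_n := \matrix_(r, s) ('X_r : P)%:F ^+ (p ^ s).

Definition power_coord e (s : 'I_n) : K := (invmx power_mx *m power_vec e) s 0.

Lemma tofrac_bracket e : (bracket p n e)%:F =
  \det (\matrix_(r < n, s < n) ('X_r : P)%:F ^+ (p ^ nth 0%N e s)).
Proof.
rewrite /bracket -det_map_mx; congr (\det _).
by apply/matrixP => r s; rewrite !mxE rmorphXn.
Qed.

Lemma det_power_mx : \det power_mx = (bracket p n (iota 0 n))%:F.
Proof.
rewrite tofrac_bracket; congr (\det _).
by apply/matrixP => r s; rewrite !mxE nth_iota.
Qed.

Lemma power_mx_unit : power_mx \in unitmx.
Proof.
by rewrite unitmxE det_power_mx unitfE tofrac_eq0 bracket_iota_neq0.
Qed.

Lemma power_coord_sum e r :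
  \sum_(s < n) ('X_r : P)%:F ^+ (p ^ s) * power_coord e s =
    ('X_r : P)%:F ^+ (p ^ e).
Proof.
have := congr1 (fun M : 'cV[K]_n => M r 0)
  (mulKVmx power_mx_unit (power_vec e)).
rewrite [LHS]mxE [RHS]mxE => <-.
by apply: eq_bigr => s _; rewrite [power_mx _ _]mxE.
Qed.

(** The matrix of the basis columns is invertible. The factor [a] is 1 when the coordinates of [v_i]
    are computed, and [- c_0] when the expansion of [v_n] is differentiated. *)
Lemma power_coord_unique e (a : K) (c : 'I_n -> K) :
    (forall r, \sum_(s < n) ('X_r : P)%:F ^+ (p ^ s) * c s =
               a * ('X_r : P)%:F ^+ (p ^ e)) ->
  forall s, c s = a * power_coord e s.
Proof.
move=> cE s; pose u : 'cV[K]_n := \col_s c s.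
have /(congr1 (mulmx (invmx power_mx))) : power_mx *m u = a *: power_vec e.
  apply/colP => r; rewrite [LHS]mxE [RHS]mxE [power_vec e r 0]mxE -cE.
  by apply: eq_bigr => k _; rewrite [power_mx _ _]mxE [u _ _]mxE.
rewrite mulKmx ?power_mx_unit // -scalemxAr.
by move=> /(congr1 (fun M : 'cV[K]_n => M s 0)); rewrite mxE [RHS]mxE.
Qed.

(* Cramer's rule: the sign comes from moving the replaced column to the end. *)
Lemma power_coordE e (t : 'I_n) :
  power_coord e t =
    (-1) ^+ (t + m) * bracket_frac p n (rcons (omit t (iota 0 n)) e).
Proof.
have tm : (t <= m)%N by rewrite -ltnS.
rewrite /power_coord /invmx power_mx_unit -scalemxAl mxE det_power_mx.
rewrite /bracket_frac mulrA [RHS]mulrC; congr (_ * _).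
rewrite tofrac_bracket (expand_det_col _ ord_max) mxE big_distrr /=.
apply: eq_bigr => r _.
rewrite !mxE /cofactor nth_rcons size_omit_iota // ltnn eqxx.
rewrite mulrA [RHS]mulrC.
rewrite (_ : row' r (col' ord_max _) = row' r (col' t power_mx)); last first.
  apply/matrixP => a b; rewrite !mxE lift_max nth_rcons size_omit_iota //.
  by rewrite ltn_ord nth_omit_iota ?ltn_ord.
rewrite mulrCA mulrA mulrA; congr (_ * _ * _).
  rewrite mulrC -!exprD -signr_odd -[RHS]signr_odd !oddD.
  by case: (odd t) (odd r) (odd m) => [] [] [].
Qed.

Variable i : nat.
Hypothesis i_gt0 : (0 < i)%N.

(** The p-th power turns [v_k] into [v_(k+1)], so coordinates shift by one index; the last column
    leaves the basis as [v_n] and is expanded again. *)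
Lemma power_coord_frobenius (s : 'I_n) :
  power_coord i s =
    (if s == 0%N :> nat then 0 else power_coord i.-1 (inord s.-1) ^+ p)
    + power_coord i.-1 ord_max ^+ p * power_coord n s.
Proof.
(* The shifted coordinates; no column is shifted onto [v_0], whence the zero. *)
pose w0 (s' : 'I_n) : K :=
  if s' == 0%N :> nat then 0 else power_coord i.-1 (inord s'.-1) ^+ p.
rewrite -[LHS]mul1r; apply/esym.
apply: (power_coord_unique
  (c := fun k => w0 k + power_coord i.-1 ord_max ^+ p * power_coord n k)) => r.
rewrite mul1r; under eq_bigr => s' _ do rewrite mulrDr mulrCA.
rewrite big_split -big_distrr power_coord_sum /=.
rewrite big_ord_recl {1}/w0 /= mulr0 add0r -[in RHS](prednK i_gt0).
rewrite (expnSr p i.-1) (exprM _ (p ^ i.-1)).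
(* The outer exponent [p] is read as [p ^ 1] to fit the additivity lemma [sum_expX]. *)
rewrite -(power_coord_sum i.-1) -[X in _ = _ ^+ X]expn1.
rewrite sum_expX ?fraction_pchar // big_ord_recr /=.
rewrite expn1 exprMn -exprM -expnSr [X in _ = _ + X]mulrC; congr (_ + _).
apply: eq_bigr => s' _; rewrite exprMn -exprM -expnSr; congr (_ * _ ^+ _).
congr (power_coord _ _); apply/val_inj; rewrite /= inordK //.
by rewrite add0n ltnS ltnW.
Qed.

Lemma frac_St_X r e : frac_St i (('X_r : P)%:F ^+ (p ^ e)) =
  if e == 0%N then ('X_r : P)%:F ^+ (p ^ i) else 0.
Proof.
case: e => [|e]; last by rewrite expnSr exprM frac_St_exp.
by rewrite expr1 frac_St_tofrac St_X tofracXn.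
Qed.

Lemma frac_St_power_coord (s : 'I_n) :
  frac_St i (power_coord n s) = - power_coord n ord0 * power_coord i s.
Proof.
apply: (power_coord_unique (c := fun s => frac_St i (power_coord n s))) => r.
(* The differentiated sum is an entry of [v_n], a p-th power because [n] is a successor. For the
   same reason only [j = 0] keeps a term with a differentiated column entry. *)
have : \sum_(j < n) frac_St i (('X_r : P)%:F ^+ (p ^ j) * power_coord n j) = 0.
  by rewrite -(leibniz_sum (@frac_StD p n i)) power_coord_sum frac_St_X.
under eq_bigr => j _ do rewrite frac_StM frac_St_X.
rewrite big_split big_ord_recl /= [X in _ + X + _]big1 => [|j _]; last first.
  exact: mul0r.
by rewrite addr0 mulNr mulrC => /eqP; rewrite addrC addr_eq0 => /eqP.
Qed.

End Coordinates.

(** * Signs, and the formula on the Dickson generators *)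

Lemma expr_sign_odd (R : comNzRingType) (p k : nat) (x : R) : odd p ->
  ((-1) ^+ k * x) ^+ p = (-1) ^+ k * x ^+ p.
Proof.
by move=> op; rewrite exprMn exprAC -[in (-1) ^+ p]signr_odd op expr1.
Qed.

(** With [q] the invariant [dickson_Q 0], the coordinate [c_0] of [v_n] is [(-1) ^+ m * q]; the
    normalising factor of [delta] is exactly the inverse of [- c_0]. *)
Lemma sign_cancel (F : fieldType) (m k : nat) (q w : F) : q != 0 ->
  (-1) ^+ m.+1 / q * ((-1) ^+ k * (- ((-1) ^+ m * q) * w)) = (-1) ^+ k * w.
Proof.
move=> q0; rewrite exprS mulN1r -[in RHS](signrMK m w).
by move: ((-1) ^+ m) ((-1) ^+ k) => a b; field.
Qed.

Lemma frac_St_dickson_Q (p m i : nat) (p_pr : prime p) (s : 'I_m.+1) :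
    odd p -> (0 < i)%N ->
  (-1) ^+ m.+1 * (dickson_Q p m.+1 0)^-1 * frac_St i (dickson_Q p m.+1 s) =
    (if s == 0%N :> nat then 0
     else - bracket_frac p m.+1 (rcons (omit s.-1 (iota 0 m.+1)) i.-1)) ^+ p
    + bracket_frac p m.+1 (rcons (iota 0 m) i.-1) ^+ p * dickson_Q p m.+1 s.
Proof.
move=> p_odd i_gt0.
(* Appending the exponent [m.+1] to the list without [t] gives the numerator of [dickson_Q t], so
   this is Cramer's rule for [v_n]. *)
have QE (t : 'I_m.+1) :
    dickson_Q p m.+1 t = (-1) ^+ (t + m) * power_coord p m.+1 t.
  by rewrite power_coordE // signrMK /dickson_Q omit_iota_rcons.
(* This presents the bracket of [R] as the Cramer numerator for the last index, whose sign has even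
   exponent [m + m]. *)
rewrite -(omit_iota_last m).
have RE : bracket_frac p m.+1 (rcons (omit m (iota 0 m.+1)) i.-1) =
    power_coord p i.-1 (ord_max : 'I_m.+1).
  by rewrite power_coordE // -signr_odd oddD addbb mul1r.
(* Passing from [s] to [s.-1] flips the Cramer sign, which accounts for the minus in [P]; as [p] is
   odd, the sign survives the p-th power. *)
have PE : (if s == 0%N :> nat then 0
     else - bracket_frac p m.+1 (rcons (omit s.-1 (iota 0 m.+1)) i.-1)) ^+ p =
     (-1) ^+ (s + m) *
     (if s == 0%N :> nat then 0
      else power_coord p i.-1 (inord s.-1 : 'I_m.+1) ^+ p).
  case: eqP => [_|/eqP s0]; first by rewrite mulr0 expr0n gtn_eqF ?prime_gt0.
  have sE : (s.-1.+1 = s)%N by rewrite prednK // lt0n.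
  rewrite -expr_sign_odd // power_coordE // inordK; last by rewrite ltnW // sE.
  by rewrite -{2}sE addSn exprS -mulrA signrMK mulN1r.
rewrite PE RE QE (leibniz_sign (@frac_StD _ _ _)).
rewrite (frac_St_power_coord p_pr) (power_coord_frobenius p_pr i_gt0 s).
have Q0 := dickson_Q0_neq0 m.+1 p_pr.
have -> : power_coord p m.+1 (ord0 : 'I_m.+1) = (-1) ^+ m * dickson_Q p m.+1 0.
  by rewrite (QE ord0) add0n signrMK.
by rewrite sign_cancel // mulrDr [_ ^+ p * (_ * _)]mulrCA.
Qed.

(** * Existence and uniqueness on the localization *)

Section Localization.
Variables (p n : nat) (p_pr : prime p).
Local Notation D := (dickson_loc n p_pr).

Lemma dickson_loc_valX (F : D) k : val (F ^+ k) = val F ^+ k.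
Proof. by elim: k => [|k IH]; rewrite ?expr0 // !exprS -IH. Qed.

(** Clearing the denominator gives [F * q' = f'] with both [f'] and [q'] in the Dickson algebra,
    where the two maps agree; the Leibniz rule and cancellation of [q'] then determine the value at
    [F]. *)
Lemma is_St_loc_unique i (d d' : D -> D) :
  is_St_loc i d -> is_St_loc i d' -> d =1 d'.
Proof.
move=> [[_ dM] dE] [[_ dM'] dE'] F.
have /dickson_locP[f [k [Df FE]]] := valP F.
have [q Dq qE] := dickson_algX_Q0 n p_pr k.
have locD g : g \in dickson_alg p n -> g%:F \in dickson_loc_mem p_pr.
  by move=> Dg; apply/dickson_locP; exists g, 0%N; rewrite expr0 divr1.
pose f' : D := DicksonLoc (locD _ Df); pose q' : D := DicksonLoc (locD _ Dq).
have q0 : val q' != 0 by rewrite /= qE expf_neq0 // dickson_Q0_neq0.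
have FqE : F * q' = f' by apply: val_inj; rewrite /= FE -qE; apply: (divfK q0).
have eq_on g (G : D) : g \in dickson_alg p n -> val G = g%:F -> d G = d' G.
  by move=> Dg GE; apply: val_inj; rewrite (dE _ _ Dg GE) (dE' _ _ Dg GE).
have := eq_on f f' Df erefl; rewrite -FqE dM dM' (eq_on q q' Dq erefl).
by move=> /addIr /(congr1 val); rewrite /= => /(mulIf q0) /val_inj.
Qed.

Variable i : nat.

Definition loc_St (F : D) : D :=
  DicksonLoc (frac_St_loc i (valP F)).

Lemma loc_St_is_St_loc : is_St_loc i loc_St.
Proof.
have dM F G : loc_St (F * G) = loc_St F * G + F * loc_St G.
  by apply: val_inj; rewrite /= frac_StM.
split; last by move=> f F _ FE; rewrite /= FE frac_St_tofrac.
split=> // c F G.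
(* Scalars act through multiplication by [loc_const], so the Leibniz rule reduces homogeneity to the
   vanishing on constants. *)
have d0 : loc_St (loc_const n p_pr c) = 0.
  by apply: val_inj; rewrite /= frac_St_tofrac St_const tofrac0.
have dD : loc_St (c *: F + G) = loc_St (c *: F) + loc_St G.
  by apply: val_inj; rewrite /= frac_StD.
by rewrite dD; congr (_ + _); rewrite [LHS]dM d0 mul0r add0r.
Qed.

Lemma loc_St_exp F : loc_St (F ^+ p) = 0.
Proof. by apply: val_inj; rewrite [LHS]/= dickson_loc_valX frac_St_exp. Qed.

End Localization.

Lemma delta_derivation (p n : nat) (p_pr : prime p)
    (d : dickson_loc n p_pr -> dickson_loc n p_pr) :
  is_derivation d -> is_derivation (delta d).
Proof.
move=> [dl dM]; split=> [c F G|F G]; rewrite /delta.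
  by rewrite dl mulrDr -scalerAr.
by rewrite dM mulrDr mulrA mulrCA.
Qed.

Theorem proposition2p7 (p n i : nat) (p_pr : prime p) (p_odd : odd p)
    (n_gt0 : (0 < n)%N) (i_gt0 : (0 < i)%N) :
  exists StL : dickson_loc n p_pr -> dickson_loc n p_pr,
    [/\ is_St_loc i StL,
        forall d : dickson_loc n p_pr -> dickson_loc n p_pr,
          is_St_loc i d -> d =1 StL,
        is_derivation (delta StL),
        forall s : nat, (s < n)%N ->
          delta StL (loc_Q n p_pr s) =
            loc_P n p_pr i s ^+ p + loc_R n p_pr i ^+ p * loc_Q n p_pr s
      & forall F : dickson_loc n p_pr,
          delta StL (F ^+ p) = 0 /\ StL (F ^+ p) = 0].
Proof.
have StLP := loc_St_is_St_loc n p_pr i.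
exists (@loc_St p n p_pr i); split=> //.
- by move=> d dP; apply: is_St_loc_unique dP StLP.
- by apply: delta_derivation; case: StLP.
- case: n n_gt0 {StLP} => // m _ s sm; apply: val_inj.
  have PE : val (loc_P m.+1 p_pr i s) = if s == 0%N then 0
      else - bracket_frac p m.+1 (rcons (omit s.-1 (iota 0 m.+1)) i.-1).
    by rewrite /loc_P; case: ifP.
  have := frac_St_dickson_Q p_pr (Ordinal sm) p_odd i_gt0.
  rewrite [X in (if X == _ then _ else _)]/= -PE => E.
  (* Products and sums pass through [val] by conversion; powers with a variable exponent require
     [dickson_loc_valX]. *)
  transitivity (val ((-1) ^+ m.+1 : dickson_loc m.+1 p_pr)
    / dickson_Q p m.+1 0 * frac_St i (dickson_Q p m.+1 s)); first by [].
  rewrite dickson_loc_valX [LHS]E -dickson_loc_valX.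
  congr (_ + _ * _); apply/esym; exact: dickson_loc_valX.
- by move=> F; rewrite /delta loc_St_exp mulr0.
Qed.
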